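(* Let $(n_k)_{k\ge 1}$ be a sequence of positive real numbers such that $$\inf_{k\ge 1} \frac{n_{k+1}}{k\, n_k} > 0.$$ Then there exists $\alpha\in\mathbb{R}$ such that the discrepancy $D_N$ of the finite sequence $\{\alpha n_k\}$, $1\le k\le N$, satisfies $D_N = O(\log N)$; that is, there is a constant $C>0$ (independent of $N$) such that $D_N\le C\log N$ for all integers $N\ge 2$.
   Context: $\{x\}$ denotes the fractional part of the real number $x$. For a sequence $\xi_1,\xi_2,\dots$ of points of $[0,1)$, the (unnormalized) discrepancy of its first $N$ points is $$D_N=\sup_{\gamma\in[0,1)}\bigl|N\gamma-\#\{j:\ 1\le j\le N,\ \xi_j\le\gamma\}\bigr|.$$ *)

(* Defs.v *)
From mathcomp Require Import all_boot all_order all_algebra.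
From mathcomp Require Import all_classical all_reals all_analysis.

Set Implicit Arguments.
Unset Strict Implicit.
Unset Printing Implicit Defensive.

Import Order.TTheory GRing.Theory Num.Theory.

Local Open Scope classical_set_scope.
Local Open Scope ring_scope.

Definition frac_part (R : realType) (x : R) : R := x - (Num.floor x)%:~R.

(* Sequences are indexed from 1; the value [xi 0] is never used.
   The real-valued [sup] returns 0 on sets without a supremum, but the set
   below contains the value at [gamma = 0] and is bounded above by [N]. *)
Definition discrepancy (R : realType) (xi : nat -> R) (N : nat) : R :=
  sup [set (`|N%:R * gamma
               - (count (fun j => xi j <= gamma) (index_iota 1 N.+1))%:R| : R)
      | gamma in [set gamma : R | 0 <= gamma < 1]].

(* Main.v *)
Require Import Defs.
From mathcomp Require Import all_boot all_order all_algebra.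
From mathcomp Require Import all_classical all_reals all_analysis.
From mathcomp Require Import lra ring zify.

Import Order.TTheory GRing.Theory Num.Theory.

Local Open Scope classical_set_scope.
Local Open Scope ring_scope.

(* Fix the van der Corput sequence [x] as a target. Since [n_(k+1)] exceeds
   [c k n_k], one can choose successive approximations
   [a_(k+1) = a_k + O(1 / n_(k+1))] with [n_k a_k = x_k] mod 1; in the limit,
   [n_k alpha] is within [K / k] of [x_k] mod 1 for every [k]. Moving the
   points [x_k] by [K / k] changes the number of them below [gamma] only by
   those [x_k] lying within [K / k] of [gamma] (or of 1, because of the
   wrap-around). Each dyadic block [2^j <= k < 2^(j+1)] consists of points of
   a [2^-(j+1)]-net, so it contributes O(K) such points, and there are
   O(log N) blocks. The discrepancy of [x] itself is O(log N). *)

(* [vdc R k] is the radical inverse of [k] in base 2; the fuel [f] only has to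
   be at least the number of binary digits of [k]. *)
Fixpoint vdc_fuel (R : realType) (f k : nat) : R :=
  if f is f'.+1 then ((odd k)%:R + vdc_fuel R f' k./2) / 2 else 0.

Definition vdc (R : realType) (k : nat) : R := vdc_fuel R k k.

Lemma vdc_fuelE (R : realType) (f k : nat) :
  (k <= f)%N -> vdc_fuel R f k = vdc R k.
Proof.
have fuel0 g : vdc_fuel R g 0 = 0.
  by elim: g => //= g ->; rewrite addr0 mul0r.
suff eq_fuel g h j : (j <= g)%N -> (j <= h)%N ->
    vdc_fuel R g j = vdc_fuel R h j by move=> kf; exact: eq_fuel.
elim: g h j => [|g IH] [|h] [|j] //; rewrite ?fuel0 // => jg jh /=.
by congr ((_ + _) / 2); apply: IH; lia.
Qed.

Lemma vdc0 (R : realType) : vdc R 0 = 0.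
Proof. by []. Qed.

Lemma vdc_half (R : realType) (k : nat) :
  vdc R k = ((odd k)%:R + vdc R k./2) / 2.
Proof.
case: k => [|k]; first by rewrite /= vdc0 addr0 mul0r.
by rewrite {1}/vdc /= vdc_fuelE //; lia.
Qed.

Lemma vdc_double (R : realType) (k : nat) : vdc R k.*2 = vdc R k / 2.
Proof. by rewrite vdc_half odd_double doubleK add0r. Qed.

Lemma vdc_doubleS (R : realType) (k : nat) :
  vdc R k.*2.+1 = (1 + vdc R k) / 2.
Proof. by rewrite vdc_half /= odd_double uphalf_double. Qed.

Lemma vdc_bounds (R : realType) (k : nat) : 0 <= vdc R k < 1.
Proof.
elim/ltn_ind: k => -[|k] IH; first by rewrite vdc0; lra.
have := IH k.+1./2 ltac:(lia); rewrite (vdc_half R k.+1).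
by case: (odd _) => /=; lra.
Qed.

(** * Discrepancy of the van der Corput sequence, by halving the index *)

(** Indices start at 0, unlike in [discrepancy], so that splitting them by parity yields two initial
    segments again. *)
Definition vdc_count (R : realType) (N : nat) (g : R) : R :=
  \sum_(0 <= k < N) (vdc R k <= g)%R%:R.

Lemma sum_even_odd (R : realType) (F : nat -> R) (N : nat) :
  \sum_(0 <= k < N) F k =
  \sum_(0 <= k < uphalf N) F k.*2 + \sum_(0 <= k < N./2) F k.*2.+1.
Proof.
have even_case j : \sum_(0 <= k < j.*2) F k =
    \sum_(0 <= k < j) F k.*2 + \sum_(0 <= k < j) F k.*2.+1.
  elim: j => [|j IH]; first by rewrite !big_nil addr0.
  by rewrite doubleS !big_nat_recr //= IH -addrA addrACA.
rewrite uphalf_half -{1}(odd_double_half N); case: (odd N) => /=.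
  by rewrite !big_nat_recr //= even_case addrAC.
by rewrite !add0n even_case.
Qed.

Lemma vdc_count_ge0 (R : realType) (N : nat) (g : R) : 0 <= vdc_count R N g.
Proof. by apply: sumr_ge0 => k _. Qed.

(** Odd indices have values at least 1/2 and even ones values below 1/2, so a threshold in either
    half of the interval leaves only one parity to count, rescaled by 2. *)
Lemma vdc_count_lo (R : realType) (N : nat) (g : R) : g < 1 / 2 ->
  vdc_count R N g = vdc_count R (uphalf N) (2 * g).
Proof.
move=> g12; rewrite /vdc_count sum_even_odd [X in _ + X]big1 ?addr0.
  apply: eq_bigr => k _; rewrite vdc_double.
  by congr (nat_of_bool _)%:R; apply/idP/idP; lra.
move=> k _; rewrite vdc_doubleS leNgt; have := vdc_bounds R k => x01.
by have -> : g < (1 + vdc R k) / 2 by lra.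
Qed.

Lemma vdc_count_hi (R : realType) (N : nat) (g : R) : 1 / 2 <= g ->
  vdc_count R N g = (uphalf N)%:R + vdc_count R N./2 (2 * g - 1).
Proof.
move=> g12; rewrite /vdc_count sum_even_odd; congr (_ + _).
  under eq_bigr => k _.
    have -> : vdc R k.*2 <= g by rewrite vdc_double; have := vdc_bounds R k; lra.
    over.
  by rewrite sumr_const_nat subn0.
apply: eq_bigr => k _; rewrite vdc_doubleS.
by congr (nat_of_bool _)%:R; apply/idP/idP; lra.
Qed.

(* Passing from [N] to its halves loses an error only when [N] is odd; this is
   what makes powers of 2 have bounded error. *)
Lemma vdc_err_half (R : realType) (B : R) (N : nat) (g : R) :
  (forall M h, (M = uphalf N \/ M = N./2) -> 0 <= h <= 1 ->
     `|vdc_count R M h - M%:R * h| <= B) ->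
  0 <= g <= 1 ->
  `|vdc_count R N g - N%:R * g| <= B + (odd N)%:R / 2.
Proof.
move=> HB g01.
have eN : N%:R = (odd N)%:R + (N./2)%:R *+ 2 :> R.
  by rewrite -[in LHS](odd_double_half N) natrD -muln2 natrM mulr_natr.
have eU : (uphalf N)%:R = (odd N)%:R + (N./2)%:R :> R.
  by rewrite uphalf_half natrD.
case: (ltP g (1 / 2)) => g12.
  have := HB (uphalf N) (2 * g) (or_introl erefl) ltac:(lra).
  rewrite (vdc_count_lo R N) // !ler_norml eU eN.
  by case: (odd N) => /=; lra.
have := HB N./2 (2 * g - 1) (or_intror erefl) ltac:(lra).
rewrite (vdc_count_hi R N) // !ler_norml eU eN.
by case: (odd N) => /=; lra.
Qed.

Lemma vdc_count1 (R : realType) (g : R) : 0 <= g -> vdc_count R 1 g = 1.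
Proof. by move=> g0; rewrite /vdc_count big_nat1 vdc0 g0. Qed.

(** Each halving costs at most 1/2, and [m] halvings bring [N] down to at most 1. *)
Lemma vdc_discrepancy (R : realType) (m N : nat) (g : R) :
  (N <= 2 ^ m)%N -> 0 <= g <= 1 ->
  `|vdc_count R N g - N%:R * g| <= 1 + m%:R / 2.
Proof.
elim: m N g => [|m IH] N g Nm g01.
  case: N Nm => [|[|//]] _.
    by rewrite /vdc_count big_nil mul0r subr0 normr0; lra.
  by rewrite vdc_count1 ?mul1r ?ler_norml; lra.
have := @vdc_err_half R (1 + m%:R / 2) N g.
move=> /(_ _ g01) H; apply: le_trans (H _) _; last first.
  by rewrite -[m.+1%:R]natr1; case: (odd N) => /=; lra.
move=> M h HM; apply: IH; move: Nm; rewrite expnS.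
by case: HM => ->; lia.
Qed.

Lemma vdc_discrepancy_pow2 (R : realType) (m : nat) (g : R) :
  0 <= g <= 1 -> `|vdc_count R (2 ^ m) g - (2 ^ m)%:R * g| <= 1.
Proof.
elim: m g => [|m IH] g g01.
  by rewrite expn0 vdc_count1 ?mul1r ?ler_norml; lra.
have := @vdc_err_half R 1 (2 ^ m.+1) g.
move=> /(_ _ g01); rewrite oddX /= mul0r addr0; apply => M h HM h01.
suff -> : M = (2 ^ m)%N by apply: IH.
by case: HM => ->; rewrite expnS mul2n ?uphalf_double ?doubleK.
Qed.

(** * Points of the sequence just below a threshold *)

(** Two estimates with error 1 are subtracted. The lower end [a] may be negative, as happens for
    [g - K / 2 ^ j] with small [j]. *)
Lemma vdc_strip (R : realType) (m : nat) (a b : R) :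
  a <= b -> 0 <= b <= 1 ->
  vdc_count R (2 ^ m) b - vdc_count R (2 ^ m) a <= (2 ^ m)%:R * (b - a) + 2.
Proof.
move=> ab b01; have := vdc_discrepancy_pow2 R m b b01.
have p0 : 0 <= (2 ^ m)%:R :> R by [].
case: (ltP a 0) => a0.
  have := vdc_count_ge0 R (2 ^ m) a; rewrite ler_norml; nra.
have := vdc_discrepancy_pow2 R m a ltac:(lra); rewrite !ler_norml; lra.
Qed.

Lemma vdc_near_block (R : realType) (K : R) (j : nat) (g : R) :
  0 <= K -> 0 <= g <= 1 ->
  \sum_(2 ^ j <= k < 2 ^ j.+1) (g - K / k%:R < vdc R k <= g)%R%:R
    <= 2 * K + 2 :> R.
Proof.
move=> K0 g01.
have p0 : 0 < (2 ^ j)%:R :> R by rewrite ltr0n expn_gt0.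
have ag : g - K / (2 ^ j)%:R <= g by rewrite gerBl divr_ge0 // ltW.
(* The shrinking strips of the block are all contained in the widest one, of width [K / 2 ^ j],
   where all indices below [2 ^ j.+1] are counted. *)
have -> : 2 * K + 2 =
    (2 ^ j.+1)%:R * (g - (g - K / (2 ^ j)%:R)) + 2 :> R.
  by rewrite expnS natrM; field; lra.
apply: le_trans (vdc_strip R j.+1 _ _ ag g01).
rewrite /vdc_count -sumrB.
rewrite [leRHS](@big_cat_nat _ _ _ (2 ^ j)) //=; last by rewrite leq_exp2l.
rewrite -[leLHS]add0r; apply: lerD.
  apply: sumr_ge0 => k _; rewrite subr_ge0 ler_nat.
  by case: (leP _ (g - _)) => //= h; rewrite (le_trans h ag).
rewrite !big_nat; apply: ler_sum => k /andP[jk _].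
have Kk : K / k%:R <= K / (2 ^ j)%:R.
  by rewrite ler_wpM2l // lef_pV2 ?posrE ?ler_nat // ltr0n; lia.
case: (leP (vdc R k) g) => xg; last first.
  by rewrite andbF [vdc R k <= _]leNgt (le_lt_trans ag xg) subr0.
rewrite andbT [vdc R k <= _]leNgt -natrB ?leq_b1 // ler_nat.
case: (ltP (g - K / k%:R)) => //= xk.
by rewrite (le_lt_trans _ xk) // lerD2l lerN2.
Qed.

Lemma vdc_near (R : realType) (K : R) (m : nat) (g : R) :
  0 <= K -> 0 <= g <= 1 ->
  \sum_(1 <= k < 2 ^ m) (g - K / k%:R < vdc R k <= g)%R%:R
    <= m%:R * (2 * K + 2) :> R.
Proof.
move=> K0 g01; elim: m => [|m IH].
  by rewrite expn0 big_geq // mul0r.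
rewrite (@big_cat_nat _ _ _ (2 ^ m)) //=; [|by rewrite expn_gt0|by rewrite leq_exp2l].
by rewrite -[m.+1%:R]natr1 mulrDl mul1r lerD ?vdc_near_block.
Qed.

(** * Construction of alpha by successive approximation *)

Lemma shadow_targets (R : realType) (n x : nat -> R) (c : R) :
  (forall k, (1 <= k)%N -> 0 < n k) -> 0 < c ->
  (forall k, (1 <= k)%N -> c * k%:R * n k <= n k.+1) ->
  exists alpha K : R, 0 <= K /\ forall k, (1 <= k)%N ->
    exists p : int, 0 <= n k * alpha - p%:~R - x k <= K / k%:R.
Proof.
move=> n0 c0 ngr.
(* This [K] serves twice: from index [K] on, [n] at least doubles at each step, and the final error
   [2 / (c * k)] is at most [K / k]. *)
pose K := Num.bound (2 / c).
have cK : 2 < c * K%:R.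
  by rewrite mulrC -ltr_pdivrMr // archi_boundP // divr_ge0 // ltW.
have K0 : (0 < K)%N.
  by case: (posnP K) cK => [->|//]; rewrite mulr0; lra.
(* Rounding up gives the least number not below [a] that hits the target of index [K + i.+1] exactly
   mod 1. This makes all later errors one-sided. *)
pose step i (a : R) : R :=
  ((Num.ceil (n (K + i.+1)%N * a - x (K + i.+1)%N))%:~R + x (K + i.+1)%N)
    / n (K + i.+1)%N.
pose a i : R := iteri i step (x K / n K).
pose b i : R := (n (K + i)%N)^-1.
have nK i : 0 < n (K + i)%N by apply: n0; lia.
have b0 i : 0 < b i by rewrite invr_gt0.
have a_target i : exists p : int, n (K + i)%N * a i = p%:~R + x (K + i)%N.
  case: i => [|i].
    by exists 0; rewrite add0r addn0 /a /= mulrC divfK // gt_eqF // n0.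
  eexists; rewrite /a /= -/(a i) {1}/step mulrC divfK ?gt_eqF //; reflexivity.
have a_step i : a i <= a i.+1 <= a i + b i.+1.
  have -> : a i.+1 = step i (a i) by [].
  rewrite /step /b ler_pdivlMr // ler_pdivrMr // mulrDl mulVf ?gt_eqF //.
  set z := (n _ * a i - _).
  have := Num.Theory.ceil_itv z; rewrite intrD.
  by rewrite /z [a i * _]mulrC => /andP[]; lra.
have b_half i : 2 * b i.+1 <= b i.
  have := ngr (K + i)%N ltac:(lia); rewrite -addnS => h.
  have h2 : 2 * n (K + i)%N <= n (K + i.+1)%N.
    apply: le_trans h; rewrite ler_pM2r // natrD mulrDr.
    have : 0 <= c * i%:R by rewrite mulr_ge0 // ltW.
    lra.
  by rewrite /b -[leRHS]mul1r ler_pdivlMr // mulrAC ler_pdivrMr // mul1r.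
(* [a] increases, [t] decreases, and alpha lies between them. *)
pose t i := a i + 2 * b i.+1.
have a_nd : {homo a : i j / (i <= j)%N >-> i <= j}.
  by apply/nondecreasing_seqP => i; have /andP[] := a_step i.
(* The factor 2 in [t] sums a geometric series: one [b i.+1] pays for the next step, the other
   covers [2 * b i.+2]. *)
have t_ni : {homo t : i j / (i <= j)%N >-> j <= i}.
  apply/nonincreasing_seqP => i; rewrite /t.
  by have /andP[_] := a_step i; have := b_half i.+1; lra.
have a_t i j : a i <= t j.
  apply: (le_trans (a_nd _ _ (leq_maxl i j))).
  apply: le_trans (t_ni _ _ (leq_maxr i j)).
  by rewrite lerDl mulr_ge0 // ltW.
pose alpha := sup (range a).
have alpha_ge i : a i <= alpha.
  apply: ub_le_sup; last by exists i.
  by exists (t 0%N) => _ [j _ <-].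
have alpha_le i : alpha <= t i.
  by apply: ge_sup; [exists (a 0%N); exists 0%N | move=> _ [j _ <-]].
exists alpha, K%:R; split => // k k1.
have k0 : 0 < k%:R :> R by rewrite ltr0n.
case: (ltnP k K) => kK.
  (* Here [K / k >= 1] and any real number is admissible. *)
  exists (Num.floor (n k * alpha - x k)).
  have := Num.Theory.floor_itv (n k * alpha - x k); rewrite intrD.
  have : 1 <= K%:R / k%:R :> R by rewrite ler_pdivlMr // mul1r ler_nat ltnW.
  by move=> ? /andP[]; lra.
have [i ki] : exists i, k = (K + i)%N by exists (k - K)%N; lia.
have [p ep] := a_target i; exists p; rewrite -ki in ep.
have -> : n k * alpha - p%:~R - x k = n k * (alpha - a i).
  by rewrite mulrBr ep; lra.
have nk0 := n0 k k1.
apply/andP; split; first by rewrite mulr_ge0 ?subr_ge0 // ltW.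
have dle : alpha - a i <= 2 * b i.+1 by have := alpha_le i; rewrite /t; lra.
rewrite ler_pdivlMr //.
have ble : b i.+1 * (c * k%:R * n k) <= 1.
  by rewrite /b mulrC ler_pdivrMr // mul1r addnS -ki ngr.
have K2 : 2 / c <= K%:R by rewrite ler_pdivrMr //; lra.
apply: le_trans K2; rewrite ler_pdivlMr //.
have h0 : 0 <= c * k%:R * n k by rewrite !mulr_ge0 // ltW.
have := ler_wpM2r h0 dle; lra.
Qed.

(** * Transfer to fractional parts and conclusion *)

(** As [y] is shifted only upwards from [x] mod 1, the indicators can differ in two ways: the shift
    crosses [g], or it passes 1 and wraps around. *)
Lemma frac_shadow (R : realType) (e x y g : R) (p : int) :
  0 <= x < 1 -> 0 <= y - p%:~R - x <= e -> 0 <= g < 1 ->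
  `|(frac_part y <= g)%R%:R - (x <= g)%R%:R|
    <= (g - e < x <= g)%R%:R + (1 - 2 * e < x <= 1)%R%:R :> R.
Proof.
move=> /andP[x0 x1] /andP[yx yxe] /andP[g0 g1].
case: (ltP (y - p%:~R) 1) => y1.
  have fl : Num.floor y = p.
    by apply: Num.Theory.floor_def; rewrite intrD; apply/andP; split; lra.
  rewrite /frac_part fl.
  case: (leP (y - p%:~R) g) => h1; case: (leP x g) => h2; rewrite /= ?subrr ?normr0 ?andbT ?andbF //=.
  - by lra.
  - have -> : g - e < x by lra.
    by rewrite sub0r normrN normr1 lerDl.
(* Wrapping gives only [1 - e <= x]. Here [e] is positive because [x < 1], so doubling it makes the
   inequality strict, in the form that [vdc_near] counts. *)
have -> : 1 - 2 * e < x <= 1 by apply/andP; split; lra.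
apply: (@le_trans _ _ 1); last by rewrite lerDr.
by rewrite ler_norml; case: (_ <= g); case: (_ <= g) => /=; lra.
Qed.

Lemma count_sum (R : realType) (P : pred nat) (N : nat) :
  (count P (index_iota 1 N.+1))%:R = \sum_(1 <= k < N.+1) (P k)%:R :> R.
Proof. by rewrite -sum1_count big_mkcond natr_sum; apply: eq_bigr => k _; case: (P k). Qed.

Lemma near_vdc_discrepancy (R : realType) (y : nat -> R) (K : R) (m N : nat) :
  0 <= K ->
  (forall k, (1 <= k)%N ->
    exists p : int, 0 <= y k - p%:~R - vdc R k <= K / k%:R) ->
  (0 < m)%N -> (N < 2 ^ m)%N ->
  discrepancy (fun k => frac_part (y k)) N <= m%:R * (6 * K + 7).
Proof.
move=> K0 near m0 Nm; apply: ge_sup.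
  by eexists; exists 0 => //=; rewrite lexx ltr01.
move=> _ [g /= g01 <-]; rewrite count_sum.
set S := \sum_(_ <= _ < _) _.
have g01' : 0 <= g <= 1 by lra.
have m1 : 1 <= m%:R :> R by rewrite ler1n.
have T1 := vdc_near R K m g K0 g01'.
(* These are the points that may wrap around. *)
have T2 := vdc_near R (2 * K) m 1 ltac:(lra) ltac:(lra).
have D := vdc_discrepancy R m N.+1 g Nm g01'.
(* Index 0 has value 0 and is always counted. Removing it changes the error by [1 - g], which
   [6 * K + 7] absorbs since [1 <= m]. *)
have E : vdc_count R N.+1 g = 1 + \sum_(1 <= k < N.+1) (vdc R k <= g)%R%:R.
  by rewrite /vdc_count big_ltn // vdc0; case/andP: g01 => ->.
set V := \sum_(_ <= _ < _) _ in E.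
have SV : `|S - V| <= m%:R * (2 * K + 2) + m%:R * (2 * (2 * K) + 2).
  apply: le_trans (lerD T1 T2).
  rewrite -big_split /= /S /V -sumrB.
  apply: le_trans (ler_norm_sum _ _ _) _.
  rewrite [leRHS](@big_cat_nat _ _ _ N.+1) //=.
  rewrite -[leLHS]addr0; apply: lerD; last first.
    by apply: sumr_ge0 => k _; rewrite addr_ge0.
  rewrite !big_nat; apply: ler_sum => k /andP[k1 _].
  have [p hp] := near k k1; rewrite -mulrA.
  exact: frac_shadow (vdc_bounds R k) hp g01.
move: SV D; rewrite E -[N.+1%:R]natr1 !ler_norml => /andP[? ?] /andP[? ?].
have ? : 0 <= m%:R * K by rewrite mulr_ge0.
by apply/andP; split; lra.
Qed.

Theorem theorem1 (R : realType) (n : nat -> R)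
  (n_pos : forall k : nat, (1 <= k)%N -> 0 < n k)
  (n_growth :
    0 < inf [set n k.+1 / (k%:R * n k) | k in [set k : nat | (1 <= k)%N]]) :
  exists alpha : R, exists C : R, 0 < C /\
    forall N : nat, (2 <= N)%N ->
      discrepancy (fun k => frac_part (alpha * n k)) N <= C * ln N%:R.
Proof.
set c := inf _ in n_growth.
have ngr k : (1 <= k)%N -> c * k%:R * n k <= n k.+1.
  move=> k1; rewrite -mulrA -ler_pdivlMr ?mulr_gt0 ?ltr0n ?n_pos //.
  apply: ge_inf; last by exists k.
  exists 0 => _ [j /= j1 <-].
  by rewrite divr_ge0 ?mulr_ge0 // ltW // n_pos.
have [alpha [K [K0 near]]] := shadow_targets R n (vdc R) c n_pos n_growth ngr.
have ln2 : 0 < ln 2 :> R by rewrite ln_gt0 // ltr1n.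
(* With [l] the integer part of the binary logarithm of [N], the bound holds with [m = l.+1]; the
   factor 2 comes from [l.+1 <= 2 * l], valid as [N >= 2]. *)
exists alpha, (2 * (6 * K + 7) / ln 2); split.
  by rewrite divr_gt0 // mulr_gt0 //; lra.
move=> N N2; have N0 : (0 < N)%N by lia.
pose l := trunc_log 2 N.
have l1 : (0 < l)%N by rewrite trunc_log_gt0 /=; lia.
have near' k : (1 <= k)%N ->
    exists p : int, 0 <= alpha * n k - p%:~R - vdc R k <= K / k%:R.
  by move=> /near[p]; rewrite mulrC; exists p.
apply: le_trans (near_vdc_discrepancy R _ K l.+1 N K0 near' isT _) _.
  exact: trunc_log_ltn.
have lnN : l%:R * ln 2 <= ln N%:R :> R.
  have := trunc_logP (isT : (1 < 2)%N) N0; rewrite -/l -(ler_nat R) natrX => h.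
  by rewrite mulr_natl -lnXn // ler_ln ?posrE ?exprn_gt0 ?ltr0n.
rewrite mulrAC ler_pdivlMr //.
have l1' : 1 <= l%:R :> R by rewrite ler1n.
apply: (@le_trans _ _ (2 * l%:R * (6 * K + 7) * ln 2)).
  by rewrite ler_wpM2r ?(ltW ln2) // ler_wpM2r -?[l.+1%:R]natr1; lra.
have := ler_wpM2l (_ : 0 <= 2 * (6 * K + 7)) lnN; lra.
Qed.
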